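(* Let $\rho_2=(1+2\ln 2)^{-1}\approx0.41906$. Let $\pi$ be drawn uniformly at random among all permutations of $[n]$, independently of $\mathbf v\sim\mathcal F$, and let $p>0$ be such that $\mathbb{E}_{\mathbf v,\pi}\big[\sum_{i\in[n]}y_i(\mathbf v,p,\pi)\big]=\rho_2$. Then \[ \mathbb{E}_{\mathbf v,\pi}[\mathrm{SW}(\mathbf v,p,\pi)]\ \ge\ \rho_2\,\mathbb{E}_{\mathbf v\sim\mathcal F}[\mathrm{SW}^*(\mathbf v)]. \]
   Context: There are $n$ agents, identified with $[n]=\{1,\dots,n\}$, and one perfectly divisible item of size $1$. Each agent $i$ has a valuation function $v_i:[0,1]\to\mathbb{R}_{\ge0}$ that is non-decreasing and concave; $v_i$ is drawn from a publicly known distribution $\mathcal F_i$, independently across agents, and $\mathbf v\sim\mathcal F=\mathcal F_1\times\cdots\times\mathcal F_n$. All expectations are assumed finite. Sequential posted pricing with linear pricing uses a price $p>0$ per unit and an ordering $\pi$: agents act in the order $\pi$; when agent $i$ acts she may buy any fraction of the still-unallocated part of the item, paying $p$ per unit, with utility $v_i(z)-pz$. $y^*_i(v_i,p)\in[0,1]$ denotes a maximizer of $z\mapsto v_i(z)-pz$ over $[0,1]$ (fixed measurable selection). With $B_\pi(i)$ the set of agents acting before $i$ in $\pi$, agent $i$ buys $y_i(\mathbf v,p,\pi)=\min\{y^*_i(v_i,p),\max\{0,1-\sum_{j\in B_\pi(i)}y^*_j(v_j,p)\}\}$. $\mathrm{SW}(\mathbf v,p,\pi)=\sum_i v_i(y_i(\mathbf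 v,p,\pi))$. $x(\mathbf v)$ is a welfare-maximizing allocation ($x_i(\mathbf v)\ge0$, $\sum_i x_i(\mathbf v)=1$, maximizing $\sum_i v_i(x_i)$) and $\mathrm{SW}^*(\mathbf v)=\sum_i v_i(x_i(\mathbf v))$. *)

(* Defs.v *)
From HB Require Import structures.
From mathcomp Require Import all_boot all_order all_fingroup all_algebra.
From mathcomp Require Import all_classical all_reals all_analysis.
Set Implicit Arguments. Unset Strict Implicit. Unset Printing Implicit Defensive.
Import Order.TTheory GRing.Theory Num.Theory.
Local Open Scope classical_set_scope.
Local Open Scope ring_scope.

Section Defs.
Context {R : realType}.

Definition valuation (v : R -> R) : Prop :=
  [/\ (forall z, 0 <= z <= 1 -> 0 <= v z),
      (forall x y, 0 <= x -> x <= y -> y <= 1 -> v x <= v y) &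
      (forall x y l, 0 <= x <= 1 -> 0 <= y <= 1 -> 0 <= l <= 1 ->
         l * v x + (1 - l) * v y <= v (l * x + (1 - l) * y))].

Definition is_demand (v : R -> R) (p z : R) : Prop :=
  0 <= z <= 1 /\ (forall z', 0 <= z' <= 1 -> v z' - p * z' <= v z - p * z).

(* Amount bought by agent i under ordering pi: agent j acts before agent i
   iff pi j < pi i (pi maps agents to positions). ys j = y*_j(v_j,p). *)
Definition bought (n : nat) (ys : 'I_n -> R) (pi : {perm 'I_n}) (i : 'I_n) : R :=
  Num.min (ys i) (Num.max 0 (1 - \sum_(j < n | (pi j < pi i)%N) ys j)).

Definition SW (n : nat) (v : 'I_n -> R -> R) (ys : 'I_n -> R) (pi : {perm 'I_n}) : R :=
  \sum_(i < n) v i (bought ys pi i).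

Definition SWopt (n : nat) (v : 'I_n -> R -> R) : R :=
  sup [set \sum_(i < n) v i (x i) | x in
        [set x : 'I_n -> R | (forall i, 0 <= x i) /\ \sum_(i < n) x i = 1]].

Definition rho2 : R := (1 + 2 * ln 2)^-1.

End Defs.

Definition mutually_independent {R : realType} {d d' : measure_display}
  {Omega : measurableType d} {T : measurableType d'} (n : nat)
  (P : probability Omega R) (X : 'I_n -> Omega -> T) : Prop :=
  forall A : 'I_n -> set T, (forall i, measurable (A i)) ->
    P (\bigcap_(i in [set: 'I_n]) (X i @^-1` A i)) =
    (\prod_(i < n) P (X i @^-1` A i))%E.

(* E_{v,pi}[f v pi] with pi uniform over permutations, independent of v *)
Definition Evpi {R : realType} {d : measure_display} {Omega : measurableType d}
  (n : nat) (P : probability Omega R) (f : Omega -> {perm 'I_n} -> R) : \bar R :=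
  ((n`!%:R : R)^-1)%:E * (\sum_(pi : {perm 'I_n}) \int[P]_(w in setT) (f w pi)%:E)%E.

(* Main.v *)
Require Import Defs.
From HB Require Import structures.
From mathcomp Require Import all_boot all_order all_fingroup all_algebra.
From mathcomp Require Import all_classical all_reals all_analysis.
From mathcomp Require Import measurable_realfun lra.
Import Order.TTheory GRing.Theory Num.Theory.
Local Open Scope classical_set_scope.
Local Open Scope ring_scope.

(** Write [y_i] for the demand and [u_i = v_i(y_i) - p y_i >= 0] for the utility
of an unrationed agent [i], and let [W_i = max(0, 1 - sum_(j != i) y_j)], which is
at most the amount left for [i] under any ordering. Concavity shows that [i]
rationed to [r] still gets utility at least [r u_i], so the welfare is at least
[p (amount sold) + sum_i W_i u_i], while [SW* <= p + sum_i u_i]. Since [W_i]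
depends only on the other agents, [E[W_i u_i] = E[W_i] E[u_i]]. The amount sold
is [min(1, sum_i y_i)] whatever the ordering, hence
[E[W_i] >= 1 - E[amount sold] = 1 - rho2 >= rho2], because [rho2 <= 1/2]. *)

(** * Bounds on the constant [rho2] *)

Lemma rho2_gt0 (R : realType) : 0 < rho2 :> R.
Proof.
rewrite /rho2 invr_gt0 ltr_wpDr// mulr_ge0// ln_ge0//; lra.
Qed.

Lemma rho2_le_half (R : realType) : rho2 <= 2^-1 :> R.
Proof.
rewrite /rho2 lef_pV2 ?posrE//; last first.
  by rewrite ltr_wpDr// mulr_ge0// ln_ge0//; lra.
(* The bound amounts to [ln 2 >= 1/2], which is [ln (1 + x) <= x] at [x = -1/2]. *)
have := @le_ln1Dx R (- 2^-1) ltac:(lra).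
rewrite (_ : 1 + - 2^-1 = 2^-1 :> R); last by lra.
by rewrite lnV ?posrE//; lra.
Qed.

(** * Utility of a single agent, full or rationed *)

Section demand.
Set Implicit Arguments.
Unset Strict Implicit.
Context {R : realType}.
Implicit Types (v : R -> R) (p y : R).

Lemma demand_utility_ge0 v p y :
  valuation v -> is_demand v p y -> 0 <= v y - p * y.
Proof.
move=> [v0 _ _] [_ /(_ 0)].
rewrite lexx ler01 mulr0 subr0 => /(_ isT); apply: le_trans.
by apply: v0; rewrite lexx ler01.
Qed.

(** Concavity between [0] and [y]; the remaining term [(1 - l) * v 0] is nonnegative and is
    dropped. *)
Lemma utility_scale v p y l : valuation v -> is_demand v p y -> 0 <= l <= 1 ->
  l * (v y - p * y) <= v (l * y) - p * (l * y).
Proof.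
move=> [v0 _ vc] [y01 _] l01.
have x01 : 0 <= (0 : R) <= 1 by rewrite lexx ler01.
have /(_ y 0 l y01 x01 l01) := vc.
rewrite mulr0 addr0 => H.
have : 0 <= (1 - l) * v 0 by rewrite mulr_ge0// ?v0//; lra.
move: H; set a := v (l * y); set b := v y; set c := v 0; lra.
Qed.

(** Here [r] is the amount left when the agent acts, and [s] a lower bound on it that can be chosen
    independent of the ordering. If [y <= r] the full utility is kept and [s <= 1]. Otherwise
    scaling [y] by [r / y] keeps the fraction [r / y] of the utility, which is at least [r] because
    [y <= 1]. *)
Lemma value_rationed v p y r s : valuation v -> is_demand v p y ->
  0 <= s -> s <= r -> r <= 1 ->
  p * Num.min y r + s * (v y - p * y) <= v (Num.min y r).
Proof.
move=> vv dy s0 sr r1.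
have u0 := demand_utility_ge0 vv dy.
have su : s * (v y - p * y) <= r * (v y - p * y) by rewrite ler_wpM2r.
case: (leP y r) => [yr|ry].
  have : r * (v y - p * y) <= 1 * (v y - p * y) by rewrite ler_wpM2r.
  lra.
have [/andP[_ y1] _] := dy.
have y0 : 0 < y by rewrite (le_lt_trans _ ry)// (le_trans s0).
have ly : r / y * y = r by rewrite divfK ?gt_eqF.
have l01 : 0 <= r / y <= 1.
  by rewrite divr_ge0 ?(ltW y0) ?(le_trans s0)//= ler_pdivrMr// mul1r ltW.
have := utility_scale vv dy l01; rewrite ly.
have : r * (v y - p * y) <= r / y * (v y - p * y).
  by rewrite ler_wpM2r// ler_peMr ?(le_trans s0)// invf_ge1.
lra.
Qed.

(** No continuity is assumed: a rational slightly to the left of [y] is a scaling of [y], so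
    [utility_scale] bounds the loss. For [y = 0] the rational [0] is exact. *)
Lemma rational_utility_approx v p y e : valuation v -> is_demand v p y -> 0 < e ->
  exists q : rat, 0 <= (ratr q : R) <= 1 /\
    v y - p * y - e <= v (ratr q) - p * ratr q.
Proof.
move=> vv dy e0; have [/andP[y0 y1] _] := dy.
have u0 := demand_utility_ge0 vv dy.
move: y0; rewrite le_eqVlt => /predU1P[y0|y0].
  by exists 0; rewrite rmorph0 lexx ler01 -y0; split => //; lra.
set u := v y - p * y in u0 *.
have ue0 : 0 < u + e by lra.
(* Scaling by this factor loses [e * u / (u + e) <= e]; the denominator is [u + e] so that [u = 0]
   is allowed. *)
have : (1 - e / (u + e)) * y < y.
  by rewrite gtr_pMl// ltrBlDr ltrDl divr_gt0.
move=> /rat_in_itvoo[q]; rewrite in_itv/= => /andP[q1 q2].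
have q0 : 0 <= ratr q :> R.
  apply: le_trans (ltW q1); rewrite mulr_ge0 ?(ltW y0)// subr_ge0.
  by rewrite ler_pdivrMr// mul1r lerDr.
exists q; split; first by rewrite q0 (le_trans (ltW q2)).
have ly : ratr q / y * y = ratr q by rewrite divfK ?gt_eqF.
have l01 : 0 <= ratr q / y <= 1.
  by rewrite divr_ge0 ?(ltW y0)//= ler_pdivrMr// mul1r ltW.
have := utility_scale vv dy l01; rewrite ly -/u; apply: le_trans.
have : (1 - e / (u + e)) * u <= ratr q / y * u.
  by rewrite ler_wpM2r// ler_pdivlMr// ltW.
apply: le_trans; rewrite mulrBl mul1r lerB// mulrAC ler_pdivrMr//.
by rewrite ler_wpM2l ?(ltW e0)//; lra.
Qed.

End demand.

(** * Bounds on sales and welfare for fixed valuations *)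

Section posted_price.
Set Implicit Arguments.
Unset Strict Implicit.
Context {R : realType} {n : nat}.
Implicit Types (v : 'I_n -> R -> R) (ys : 'I_n -> R) (pi : {perm 'I_n}).

Lemma bought_ge0 ys pi i : (forall i, 0 <= ys i) -> 0 <= bought ys pi i.
Proof. by move=> ys0; rewrite /bought le_min ys0 le_max lexx. Qed.

Lemma bought_le ys pi i : bought ys pi i <= ys i.
Proof. by rewrite /bought ge_min lexx. Qed.

(** If some agent is rationed, the earliest such agent takes all that is left after unrationed
    predecessors, so the item is exhausted. Otherwise all demands are met and the last term covers
    the unsold part. *)
Lemma sum_bought_ge ys pi : (forall i, 0 <= ys i) ->
  1 <= \sum_i bought ys pi i + Num.max 0 (1 - \sum_i ys i).
Proof.
move=> ys0; case: (pselect (exists i, bought ys pi i < ys i)) => [[i0 i0P]|H].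
  case: (@arg_minnP _ i0 (fun i => bought ys pi i < ys i) (fun i => pi i : nat) i0P) => i iP imin.
  have -> : \sum_i bought ys pi i =
    bought ys pi i + (\sum_(j < n | (pi j < pi i)%N) bought ys pi j +
      \sum_(j < n | (j != i) && ~~ (pi j < pi i)%N) bought ys pi j).
    rewrite (bigD1 i)//= (bigID (fun j : 'I_n => (pi j < pi i)%N))/=.
    congr (_ + (_ + _)); apply: eq_bigl => j.
    by case: eqVneq => [->|]; rewrite ?ltnn.
  have -> : \sum_(j < n | (pi j < pi i)%N) bought ys pi j =
      \sum_(j < n | (pi j < pi i)%N) ys j.
    apply: eq_bigr => j ji; apply/eqP; rewrite eq_le bought_le/= leNgt.
    by apply/negP => /imin; rewrite leqNgt ji.
  have : 0 <= \sum_(j < n | (j != i) && ~~ (pi j < pi i)%N) bought ys pi j.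
    by apply: sumr_ge0 => j _; exact: bought_ge0.
  (* Agent [i] is rationed, so the minimum in [bought] is attained by the amount left. *)
  have : 1 - \sum_(j < n | (pi j < pi i)%N) ys j <= bought ys pi i.
    move: iP; rewrite /bought; set m := Num.max _ _; case: (leP (ys i) m); first by rewrite ltxx.
    by rewrite /m le_max lexx orbT.
  have : 0 <= Num.max 0 (1 - \sum_i ys i) by rewrite le_max lexx.
  lra.
have -> : \sum_i bought ys pi i = \sum_i ys i.
  apply: eq_bigr => i _; apply/eqP; rewrite eq_le bought_le/= leNgt.
  by apply/negP => h; apply: H; exists i.
have : 1 - \sum_i ys i <= Num.max 0 (1 - \sum_i ys i) by rewrite le_max lexx orbT.
lra.
Qed.

(** This is [value_rationed] agent by agent: the predecessors of [i] are among the agents other than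
    [i], so what all the others would leave is at most what [i] finds. *)
Lemma SW_ge v p ys pi : (forall i, valuation (v i)) ->
  (forall i, is_demand (v i) p (ys i)) ->
  p * \sum_i bought ys pi i +
  \sum_i Num.max 0 (1 - \sum_(j | j != i) ys j) * (v i (ys i) - p * ys i)
  <= SW v ys pi.
Proof.
move=> vv dy; rewrite /SW mulr_sumr -big_split/=; apply: ler_sum => i _.
have ys0 j : 0 <= ys j by case: (dy j) => /andP[].
apply: value_rationed => //.
- by rewrite le_max lexx.
- rewrite ge_max !le_max lexx/= lerB ?orbT//.
  rewrite [leRHS](bigID (fun j : 'I_n => (pi j < pi i)%N))/=.
  rewrite [leLHS](_ : _ = \sum_(j < n | (j != i) && (pi j < pi i)%N) ys j).
    by rewrite lerDl sumr_ge0.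
  by apply: eq_bigl => j; case: eqVneq => [->|]; rewrite ?ltnn.
- by rewrite ge_max ler01 gerBl sumr_ge0.
Qed.

(** The share [x i] of any allocation is a purchase open to agent [i], hence no better than the
    demand, and the payments for all shares add up to [p]. *)
Lemma SWopt_le v p ys : 0 <= p -> (forall i, valuation (v i)) ->
  (forall i, is_demand (v i) p (ys i)) ->
  SWopt v <= p + \sum_i (v i (ys i) - p * ys i).
Proof.
move=> p0 vv dy.
have u0 i : 0 <= v i (ys i) - p * ys i by exact: demand_utility_ge0.
rewrite /SWopt; set A := (X in sup X).
(* Without agents there is no allocation, and [sup] takes its default value [0]. *)
have [->|/set0P A0] := eqVneq A set0; first by rewrite sup0 addr_ge0// sumr_ge0.
apply: ge_sup => // _ [x [x0 x1] <-].
rewrite -[leLHS](addrNK (p * \sum_i x i)) addrC x1 mulr1 lerD2l.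
rewrite -[in leLHS](mulr1 p) -x1 mulr_sumr -sumrB; apply: ler_sum => i _.
have [_] := dy i; apply; rewrite x0/= -x1 (bigD1 i)//= lerDl.
exact: sumr_ge0.
Qed.

(** The whole item can be given to [i]. This later provides the integrable bound on the
    utilities. *)
Lemma value_le_SWopt v i z : (forall i, valuation (v i)) -> 0 <= z <= 1 ->
  v i z <= SWopt v.
Proof.
move=> vv /andP[z0 z1]; apply: (@le_trans _ _ (v i 1)).
  by have [_ + _] := vv i; apply.
have v0 j x : 0 <= x <= 1 -> 0 <= v j x by have [+ _ _] := vv j; apply.
apply: (@le_trans _ _ (\sum_j v j (i == j)%:R)).
  rewrite (bigD1 i)//= eqxx lerDl sumr_ge0// => j _; apply: v0.
  by case: eqP; rewrite ?lexx ?ler01.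
apply: ub_le_sup.
  (* [ub_le_sup] requires the welfare values to be bounded above; monotonicity gives this bound. *)
  exists (\sum_j v j 1) => _ [x [x0 x1] <-]; apply: ler_sum => j _.
  have [_ + _] := vv j; apply => //.
  by rewrite -x1 (bigD1 j)//= lerDl sumr_ge0.
exists (fun j => (i == j)%:R) => //; split => [j|]; first by rewrite ler0n.
by rewrite (bigD1 i)//= eqxx big1 ?addr0// => j; rewrite eq_sym => /negPf ->.
Qed.

End posted_price.

(** * Measurability of the utility *)

Section utility.
Set Implicit Arguments.
Unset Strict Implicit.

(* The demand enters [val] through its second argument, in which no joint
   measurability is available; but the utility is the supremum of
   [val t q - p q] over the rational [q] in [0, 1]. *)
Lemma measurable_utility (R : realType) d (T : measurableType d)
    (val : T -> R -> R) (y : T -> R) (p : R) :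
  (forall t, valuation (val t)) ->
  (forall z, measurable_fun setT (fun t => val t z)) ->
  (forall t, is_demand (val t) p (y t)) ->
  measurable_fun setT (fun t => val t (y t) - p * y t).
Proof.
move=> vv mv dy.
(* Enumeration of the rationals of [[0, 1]]; all other codes go to [0], also in the interval, so
   every [q k] is an admissible purchase. *)
pose q (k : nat) : R := if (unpickle k : option rat) is Some r then
  if 0 <= (ratr r : R) <= 1 then ratr r else 0 else 0.
have q01 k : 0 <= q k <= 1.
  rewrite /q; case: unpickle => [r|]; last by rewrite lexx ler01.
  by case: ifP => //; rewrite lexx ler01.
pose h k t := val t (q k) - p * q k.
have hu t : ubound (range (h ^~ t)) (val t (y t) - p * y t).
  by move=> _ [k _ <-]; have [_] := dy t; apply.
rewrite (_ : (fun t => _) = fun t => sups (h ^~ t) 0).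
  apply: measurable_fun_sups => [t _|k]; first by eexists; exact: hu.
  by apply: measurable_funB => //; exact: mv.
apply/funext => t; rewrite /sups/= (_ : sdrop _ _ = range (h ^~ t)); last first.
  by apply/seteqP; split => _ [k _ <-]; exists k.
apply/eqP; rewrite eq_le; apply/andP; split; last first.
  by apply: ge_sup (hu t); exists (h 0%N t); exists 0%N.
apply/ler_addgt0Pr => e e0; rewrite -lerBlDr.
have [r [r01 re]] := rational_utility_approx (vv t) (dy t) e0.
apply: le_trans re _; apply: ub_le_sup; first by eexists; exact: hu.
by exists (pickle r) => //; rewrite /h /q pickleK r01.
Qed.

End utility.

(** * Independence of one agent from all the others *)

Section independence.
Set Implicit Arguments.
Unset Strict Implicit.
Context {R : realType} {d : measure_display} {Omega : measurableType d}.
Variable P : probability Omega R.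

(** The joint law of [X] and [Y] agrees with the product of the marginals on rectangles, hence
    everywhere; Tonelli then splits the integral. *)
Lemma ge0_integralM_indep (X Y : Omega -> R) :
  measurable_fun setT X -> measurable_fun setT Y ->
  (forall w, 0 <= X w) -> (forall w, 0 <= Y w) ->
  (forall A B, measurable A -> measurable B ->
    P (X @^-1` A `&` Y @^-1` B) = P (X @^-1` A) * P (Y @^-1` B))%E ->
  (\int[P]_w (X w * Y w)%:E = \int[P]_w (X w)%:E * \int[P]_w (Y w)%:E)%E.
Proof.
move=> mX mY X0 Y0 XY.
pose X' : {mfun Omega >-> R} := HB.pack X (isMeasurableFun.Build _ _ _ _ _ mX).
pose Y' : {mfun Omega >-> R} := HB.pack Y (isMeasurableFun.Build _ _ _ _ _ mY).
have mZ : measurable_fun setT (fun w => (X w, Y w)).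
  exact: measurable_fun_pair.
pose Z : {mfun Omega >-> (R * R)%type} :=
  HB.pack (fun w => (X w, Y w)) (isMeasurableFun.Build _ _ _ _ _ mZ).
(* Absolute values make the integrand nonnegative on the whole plane, not only on the range of
   [(X, Y)]. *)
have mn : measurable_fun setT (fun x : R => `|x|%:E).
  by apply/measurable_EFinP; exact: normr_measurable.
have mf : measurable_fun setT (fun z : R * R => (`|z.1| * `|z.2|)%:E).
  apply/measurable_EFinP; apply: measurable_funM.
    exact: measurableT_comp (@normr_measurable _ setT) measurable_fst.
  exact: measurableT_comp (@normr_measurable _ setT) measurable_snd.
transitivity (\int[distribution P Z]_z (`|z.1| * `|z.2|)%:E)%E.
  rewrite (ge0_integral_distribution Z)//.
  by apply: eq_integral => w _ /=; rewrite !ger0_norm.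
transitivity (\int[distribution P X' \x distribution P Y']_z (`|z.1| * `|z.2|)%:E)%E.
  apply: eq_measure_integral => A mA _; apply/esym.
  exact: product_measure_unique.
rewrite fubini_tonelli1//=.
rewrite /fubini_F/=.
under eq_integral => x _.
  under eq_integral do rewrite EFinM.
  rewrite ge0_integralZl//=.
  over.
rewrite ge0_integralZr//; last first.
  by apply: integral_ge0 => x _; rewrite lee_fin.
rewrite (ge0_integral_distribution X')// (ge0_integral_distribution Y')//.
by congr (_ * _)%E; apply: eq_integral => w _ /=; rewrite ger0_norm.
Qed.

Context {d' : measure_display} {T : measurableType d'} {n : nat}.
Variable V : 'I_n -> Omega -> T.
Hypothesis mV : forall i, measurable_fun setT (V i).
Hypothesis indepV : mutually_independent P V.

(* A pi-system generating the sigma-algebra of the valuations of the agents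
   other than [i]. *)
Definition others_boxes (i : 'I_n) : set (set Omega) :=
  [set B | exists2 A : 'I_n -> set T, (forall j, measurable (A j)) &
    B = \bigcap_(j in [set j | j != i]) (V j @^-1` A j)].

Let others_boxes_setI i : setI_closed (others_boxes i).
Proof.
move=> _ _ [A mA ->] [B mB ->]; exists (fun j => A j `&` B j).
  by move=> j; exact: measurableI.
by rewrite -bigcapI.
Qed.

Let measurable_preimage i A : measurable A -> measurable (V i @^-1` A).
Proof. by move=> mA; rewrite -[_ @^-1` _]setTI; exact: mV. Qed.

Let others_boxes_measurable i : others_boxes i `<=` measurable.
Proof.
move=> _ [A mA ->]; apply: fin_bigcap_measurable; first exact: finite_finset.
by move=> j _; exact: measurable_preimage.
Qed.

(** Adding a condition on coordinate [i] turns a box of the others into a full box, to which mutual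
    independence applies. *)
Let P_others_boxes i A B : measurable A -> others_boxes i B ->
  (P (V i @^-1` A `&` B) = P (V i @^-1` A) * P B)%E.
Proof.
move=> mA [C mC ->].
have key D : measurable D ->
    (P (V i @^-1` D `&` \bigcap_(j in [set j | j != i]) (V j @^-1` C j)) =
     P (V i @^-1` D) * \prod_(j < n | j != i) P (V j @^-1` C j))%E.
  move=> mD; pose E j := if j == i then D else C j.
  have mE j : measurable (E j) by rewrite /E; case: ifP.
  transitivity (P (\bigcap_(j in [set: 'I_n]) (V j @^-1` E j))).
    congr (P _); apply/seteqP; split => w.
      move=> [Di Cj] j _; rewrite /E/=; case: eqVneq => [->//|ji].
      exact: Cj.
    move=> H; split; first by have := H i Logic.I; rewrite /E/= eqxx.
    by move=> j /= /negPf ji; have := H j Logic.I; rewrite /E/= ji.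
  rewrite indepV// (bigD1 i)//= /E eqxx; congr (_ * _)%E.
  by apply: eq_bigr => j /negPf ->.
(* The trivial condition [setT] on coordinate [i] identifies the remaining product as the
   probability of the box. *)
rewrite key//; congr (_ * _)%E; have := key setT measurableT.
by rewrite preimage_setT setTI probability_setT mul1e.
Qed.

Lemma P_others_sigma i A B : measurable A -> <<s others_boxes i >> B ->
  (P (V i @^-1` A `&` B) = P (V i @^-1` A) * P B)%E.
Proof.
move=> mA sB; have mE := measurable_preimage i mA.
have r0 : 0 <= fine (P (V i @^-1` A)) by exact: fine_ge0.
have rE : (fine (P (V i @^-1` A)))%:E = P (V i @^-1` A).
  by rewrite fineK// fin_num_measure.
transitivity (mrestr P mE B); first by rewrite /mrestr setIC.
transitivity (mscale (NngNum r0) P B); last by rewrite /mscale/= rE.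
apply: (g_sigma_algebra_measure_unique (others_boxes i) _ (fun=> setT)) sB => //.
- move=> _; exists (fun=> setT) => //; apply/seteqP; split => //.
- by rewrite bigcup_const//; exists 0%N.
- by move=> C HC; rewrite /= /mrestr /mscale /= rE setIC P_others_boxes.
- move=> _; rewrite /= /mrestr setTI; apply: le_lt_trans (probability_le1 P mE) _.
  exact: ltry.
Qed.

Lemma measurable_fun_others i j (f : T -> R) : j != i -> measurable_fun setT f ->
  @measurable_fun _ _ (g_sigma_algebraType (others_boxes i)) R setT (f \o V j).
Proof.
move=> ji mf _ B mB; rewrite setTI; apply: sub_sigma_algebra.
exists (fun k => if k == j then f @^-1` B else setT).
  by move=> k; case: ifP => // _; rewrite -[_ @^-1` _]setTI; exact: mf.
apply/seteqP; split => w /= Hw; first by move=> k _ /=; case: eqVneq => [->|].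
by have := Hw j ji; rewrite /= eqxx.
Qed.

Lemma ge0_integralM_others i (f : T -> R) (g : Omega -> R) :
  measurable_fun setT f ->
  @measurable_fun _ _ (g_sigma_algebraType (others_boxes i)) R setT g ->
  (forall t, 0 <= f t) -> (forall w, 0 <= g w) ->
  (\int[P]_w (g w * f (V i w))%:E =
   \int[P]_w (g w)%:E * \int[P]_w (f (V i w))%:E)%E.
Proof.
move=> mf mg f0 g0.
have sub : <<s others_boxes i >> `<=` measurable.
  exact: smallest_sub (@sigma_algebra_measurable _ Omega) (@others_boxes_measurable i).
have mg' B : measurable B -> <<s others_boxes i >> (g @^-1` B).
  by move=> mB; have := mg measurableT B mB; rewrite setTI.
under eq_integral do rewrite mulrC.
rewrite (@ge0_integralM_indep (f \o V i) g)//; first exact: muleC.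
- exact: measurableT_comp.
- by move=> _ B mB; rewrite setTI; apply: sub; exact: mg'.
- by move=> w; exact: f0.
move=> A B mA mB; rewrite comp_preimage P_others_sigma//; last exact: mg'.
by rewrite -[_ @^-1` _]setTI; exact: mf.
Qed.

End independence.

(** * Integrability and passage to real-valued expectations *)

Section expectation.
Set Implicit Arguments.
Unset Strict Implicit.
Context {R : realType} {d : measure_display} {Omega : measurableType d}.
Variable P : probability Omega R.

Lemma measurable_sum_cond d1 (X : measurableType d1) (D : set X) (I : Type)
    (s : seq I) (Q : pred I) (h : I -> X -> R) :
  (forall i, Q i -> measurable_fun D (h i)) ->
  measurable_fun D (fun x => \sum_(i <- s | Q i) h i x).
Proof.
move=> mh; under eq_fun do rewrite big_mkcond/=.
by apply: measurable_sum => i; case: (boolP (Q i)) => // /mh.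
Qed.

Lemma integrable_ge0_le (f g : Omega -> R) : measurable_fun setT f ->
  (forall w, 0 <= f w <= g w) -> P.-integrable setT (EFin \o g) ->
  P.-integrable setT (EFin \o f).
Proof.
move=> mf fg; apply: le_integrable => //; first exact/measurable_EFinP.
move=> w _ /=; rewrite lee_fin; have /andP[f0 fw] := fg w.
by rewrite !ger0_norm// (le_trans f0).
Qed.

Lemma integrable_ge0_bounded (f : Omega -> R) (c : R) : measurable_fun setT f ->
  (forall w, 0 <= f w <= c) -> P.-integrable setT (EFin \o f).
Proof.
move=> mf fc; apply: (@integrable_ge0_le f (cst c)) => //.
exact: finite_measure_integrable_cst.
Qed.

Lemma integrable_sumr (I : Type) (s : seq I) (f : I -> Omega -> R) :
  (forall i, P.-integrable setT (EFin \o f i)) ->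
  P.-integrable setT (EFin \o (fun w => \sum_(i <- s) f i w)).
Proof.
move=> intf; rewrite (_ : _ \o _ = fun w => (\sum_(i <- s) (f i w)%:E)%E).
  by apply: integrable_sum => // i _; exact: intf.
by apply/funext => w /=; rewrite sumEFin.
Qed.

Lemma Rintegral_sum (I : Type) (s : seq I) (f : I -> Omega -> R) :
  (forall i, P.-integrable setT (EFin \o f i)) ->
  \int[P]_w (\sum_(i <- s) f i w) = \sum_(i <- s) \int[P]_w f i w.
Proof.
move=> intf; elim: s => [|i s IHs].
  rewrite big_nil; under eq_Rintegral do rewrite big_nil.
  by rewrite Rintegral_cst// mul0r.
rewrite big_cons -IHs -RintegralD//; last exact: integrable_sumr.
by apply: eq_Rintegral => w _; rewrite big_cons.
Qed.

Lemma Rintegral_probability_cst (c : R) : \int[P]_w cst c w = c.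
Proof.
rewrite Rintegral_cst//= -[RHS]mulr1; congr (_ * _).
by have -> := @probability_setT _ _ _ P.
Qed.

Lemma EFin_Rintegral (f : Omega -> R) : P.-integrable setT (EFin \o f) ->
  (\int[P]_w (f w)%:E)%E = (\int[P]_w f w)%:E.
Proof. by move=> intf; rewrite /Rintegral fineK// integrable_fin_num. Qed.

Lemma EvpiE (n : nat) (f : Omega -> {perm 'I_n} -> R) :
  (forall pi, P.-integrable setT (EFin \o f ^~ pi)) ->
  Evpi P f = ((n`!%:R)^-1 * \sum_pi \int[P]_w f w pi)%:E.
Proof.
move=> intf; rewrite /Evpi EFinM -sumEFin; congr (_ * _)%E.
by apply: eq_bigr => pi _; rewrite EFin_Rintegral.
Qed.

End expectation.

(** * Assembly of the expected welfare bound *)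

Theorem mainTheorem4 (R : realType) (d d' : measure_display)
  (Omega : measurableType d) (P : probability Omega R)
  (T : measurableType d') (val : T -> R -> R) (n : nat)
  (V : 'I_n -> Omega -> T)
  (ystar : 'I_n -> (R -> R) -> R -> R) (p : R) :
  (forall t, valuation (val t)) ->
  (forall i, measurable_fun setT (V i)) ->
  mutually_independent P V ->
  (forall z, measurable_fun setT (fun t => val t z)) ->
  (forall i t, is_demand (val t) p (ystar i (val t) p)) ->
  (forall i, measurable_fun setT (fun t => ystar i (val t) p)) ->
  (forall pi : {perm 'I_n}, P.-integrable setT (fun w =>
     (SW (fun i => val (V i w)) (fun i => ystar i (val (V i w)) p) pi)%:E)) ->
  P.-integrable setT (fun w => (SWopt (fun i => val (V i w)))%:E) ->
  0 < p ->
  Evpi P (fun w pi => \sum_(i < n) bought (fun j => ystar j (val (V j w)) p) pi i)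
    = (rho2 : R)%:E ->
  (Evpi P (fun w pi => SW (fun i => val (V i w)) (fun i => ystar i (val (V i w)) p) pi)
    >= (rho2 : R)%:E * \int[P]_(w in setT) (SWopt (fun i => val (V i w)))%:E)%E.
Proof.
move=> vv mV iV mv dy my intSW intopt p0.
pose Y j w := ystar j (val (V j w)) p.
pose u j t := val t (ystar j (val t) p) - p * ystar j (val t) p.
(* [r] is the part left unsold to everyone, and [W i] what [i] would find when acting last. *)
pose r w := Num.max 0 (1 - \sum_j Y j w).
pose W i w := Num.max 0 (1 - \sum_(j | j != i) Y j w).
have Y01 j w : 0 <= Y j w <= 1 by case: (dy j (V j w)).
have Y0 j w : 0 <= Y j w by case/andP: (Y01 j w).
have mY j : measurable_fun setT (Y j) by exact: measurableT_comp (my j) (mV j).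
have mu j : measurable_fun setT (u j).
  exact: (@measurable_utility _ _ _ val (fun t => ystar j (val t) p)).
have u0 j t : 0 <= u j t by exact: demand_utility_ge0.
have mW i : @measurable_fun _ _ (g_sigma_algebraType (others_boxes V i)) R setT (W i).
  apply: measurable_maxr => //; apply: measurable_funB => //.
  apply: measurable_sum_cond => j ji.
  exact: measurable_fun_others ji (my j).
have mW' i : measurable_fun setT (W i).
  apply: measurable_maxr => //; apply: measurable_funB => //.
  exact: measurable_sum_cond.
have W01 i w : 0 <= W i w <= 1.
  by rewrite /W le_max lexx/= ge_max ler01 gerBl sumr_ge0.
have intW i := integrable_ge0_bounded P (mW' i) (W01 i).
have r01 w : 0 <= r w <= 1 by rewrite /r le_max lexx/= ge_max ler01 gerBl sumr_ge0.
have mr : measurable_fun setT r.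
  by apply: measurable_maxr => //; apply: measurable_funB => //; exact: measurable_sum.
have intr := integrable_ge0_bounded P mr r01.
(* Dominated by the optimum: the utility is at most the value of the demand, hence at most
   [SWopt]. *)
have intu i : P.-integrable setT (EFin \o (u i \o V i)).
  apply: integrable_ge0_le intopt; first exact: measurableT_comp (mu i) (mV i).
  move=> w; rewrite u0/= /u; apply: (@le_trans _ _ (val (V i w) (Y i w))).
    by rewrite -/(Y i w) gerBl mulr_ge0 ?(ltW p0).
  exact: (@value_le_SWopt _ _ (fun i => val (V i w)) i).
have intWu i : P.-integrable setT (EFin \o (fun w => W i w * u i (V i w))).
  apply: integrable_ge0_le (intu i).
    by apply: measurable_funM => //; exact: measurableT_comp (mu i) (mV i).
  by move=> w; have /andP[W0 W1] := W01 i w; rewrite mulr_ge0//= ler_piMl.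
pose S (pi : {perm 'I_n}) w := \sum_i bought (Y^~ w) pi i.
have intS pi : P.-integrable setT (EFin \o S pi).
  apply: integrable_sumr => i; apply: (@integrable_ge0_bounded _ _ _ P _ 1).
    apply: measurable_minr => //; apply: measurable_maxr => //.
    apply: measurable_funB => //.
    exact: measurable_sum_cond.
  move=> w; rewrite bought_ge0//=; apply: le_trans (bought_le _ _ _) _.
  by case/andP: (Y01 i w).
have WuE i : \int[P]_w (W i w * u i (V i w)) =
    \int[P]_w W i w * \int[P]_w u i (V i w).
  apply: EFin_inj; rewrite EFinM -!EFin_Rintegral//.
    by apply: ge0_integralM_others => // w; case/andP: (W01 i w) => ->.
  exact: intu.
have Ui0 i : 0 <= \int[P]_w u i (V i w) by apply: Rintegral_ge0 => w _.
pose U := \sum_i \int[P]_w u i (V i w).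
have U0 : 0 <= U by exact: sumr_ge0.
pose c := \int[P]_w r w.
(* [c] links sales to [W]: [Sc] and [cW] together give [1 - E[S pi] <= c <= E[W i]], with [c] the
   same for all orderings and agents. *)
have Sc pi : 1 <= \int[P]_w S pi w + c.
  rewrite -RintegralD// -(_ : \int[P]_w cst 1 w = 1); last first.
    exact: Rintegral_probability_cst.
  apply: le_Rintegral => //; first exact: finite_measure_integrable_cst.
    exact: (integrableD measurableT (intS pi) intr).
  by move=> w _; exact: sum_bought_ge.
have cW i : c <= \int[P]_w W i w.
  apply: le_Rintegral => // w _; rewrite /r /W ge_max !le_max lexx/= lerB ?orbT//.
  by rewrite [leRHS](bigD1 i)//= lerDr.
have SWS pi : p * \int[P]_w S pi w + c * U <=
    \int[P]_w SW (fun i => val (V i w)) (Y^~ w) pi.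
  apply: (@le_trans _ _ (\int[P]_w (p * S pi w + \sum_i W i w * u i (V i w)))).
    rewrite RintegralD//; last 2 first.
    - exact: (integrableZl measurableT p (intS pi)).
    - exact: integrable_sumr.
    rewrite RintegralZl// (Rintegral_sum _ intWu) lerD2l mulr_sumr; apply: ler_sum => i _.
    by rewrite WuE ler_wpM2r.
  apply: le_Rintegral => //.
    exact: (integrableD measurableT (integrableZl measurableT p (intS pi))
      (integrable_sumr _ intWu)).
    exact: intSW.
  by move=> w _; apply: (@SW_ge _ _ (fun i => val (V i w)) p (Y^~ w) pi) => i; [exact: vv|exact: dy].
have optU : \int[P]_w SWopt (fun i => val (V i w)) <= p + U.
  rewrite /U -(Rintegral_sum _ intu) -[X in X + _](_ : \int[P]_w cst p w = p); last first.
    exact: Rintegral_probability_cst.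
  rewrite -RintegralD//; first last.
  - exact: integrable_sumr.
  - exact: finite_measure_integrable_cst.
  apply: le_Rintegral => //.
    have ip : P.-integrable setT (EFin \o cst p) by exact: finite_measure_integrable_cst.
    have iu := integrable_sumr (index_enum 'I_n) intu.
    exact: (integrableD measurableT ip iu).
  move=> w _; apply: (@SWopt_le _ _ (fun i => val (V i w)) p (Y^~ w)) => [|i|i].
  - exact: ltW.
  - exact: vv.
  - exact: dy.
rewrite EvpiE// => -[avgS]; rewrite EvpiE// EFin_Rintegral// -EFinM lee_fin.
have N0 : 0 < n`!%:R :> R by rewrite ltr0n fact_gt0.
have sumc (x : R) : \sum_(pi : {perm 'I_n}) x = n`!%:R * x.
  by rewrite sumr_const -[in RHS]card_Sn mulr_natl.
(* Constants are rewritten as averages over orderings, so that the bounds [Sc] and [SWS] can be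
   summed termwise. *)
have avg (x : R) : x = (n`!%:R)^-1 * \sum_(pi : {perm 'I_n}) x.
  by rewrite sumc mulKf// gt_eqF.
have rc : 1 <= rho2 + c.
  rewrite [leLHS]avg -avgS [c in leRHS]avg -mulrDr -big_split/= ler_wpM2l//.
  by apply: ler_sum => pi _; exact: Sc.
(* [c >= 1 - rho2 >= rho2], so this quantity dominates [rho2 * (p + U)]. *)
apply: (@le_trans _ _ (p * rho2 + c * U)).
  have r0 := rho2_gt0 R; have r1 := rho2_le_half R.
  apply: (@le_trans _ _ (rho2 * (p + U))); first by rewrite ler_wpM2l// ltW.
  by rewrite mulrDr mulrC lerD2l ler_wpM2r//; lra.
rewrite -avgS [c * U]avg mulrCA mulr_sumr -mulrDr -big_split/= ler_wpM2l//.
by apply: ler_sum => pi _; exact: SWS.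
Qed.
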